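(* Let $F\in\mathbb{Z}_{\ge 0}$ and consider a network of $n$ agents given by a finite (directed or undirected) graph $(\mathcal{V},\mathcal{E})$, with designated leader set $\mathcal{L}\subset\mathcal{V}$, misbehaving set $\mathcal{A}\subseteq\mathcal{V}$ and normal agents $\mathcal{N}=\mathcal{V}\setminus(\mathcal{L}\cup\mathcal{A})$. The intersection $\mathcal{L}\cap\mathcal{A}$ is allowed to be nonempty (i.e. $|\mathcal{L}\cap\mathcal{A}|\ge 0$). Assume that $\mathcal{A}$ satisfies the $F$-local adversary model and that the normal agents apply the W-MSR algorithm with parameter $F$. Suppose there exist a time $t_C$ and a constant $C_L\in\mathbb{R}$ such that the reference signal satisfies $x_r[t]=C_L$ for all $t\ge t_C$. If the network is strongly $(2F+1)$-robust with respect to $\mathcal{L}$, then $$\lim_{t\to\infty}|x_i[t]-x_r[t]|=0\quad\text{for all } i\in\mathcal{N}.$$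
   Context: Graph: $\mathcal{V}=\{1,\dots,n\}$ is the set of agents; an edge $(j,i)\in\mathcal{E}$ ($j\ne i$) means that $i$ receives information from $j$. In-neighbors: $\mathcal{V}_i=\{j:(j,i)\in\mathcal{E}\}$; inclusive neighbors: $\mathcal{J}_i=\mathcal{V}_i\cup\{i\}$. Undirected graphs are treated as digraphs with $(i,j)\in\mathcal{E}\iff(j,i)\in\mathcal{E}$. Time is discrete, $t\in\mathbb{Z}_{\ge0}$, and agents have real-valued states $x_i[t]$. Reference: $x_r[t]\in\mathbb{R}$ is a reference signal with $x_r[t+1]=f_r(t,x_r[t])$, where $f_r$ is a (time-dependent) step function. Agents: $\mathcal{V}=\mathcal{N}\cup\mathcal{L}\cup\mathcal{A}$. Agents in $\mathcal{L}\setminus\mathcal{A}$ behave as leaders: $x_i[t]=x_r[t]$ for all $t$. Agents in $\mathcal{A}$ are misbehaving: at each time they may send arbitrary real values, possibly different ones to different out-neighbors. Agents not in $\mathcal{A}$ send their true state $x_j[t]$ to all out-neighbors. Receivers do not know which type their in-neighbors are. $F$-local adversary model: $|\mathcal{J}_i\cap\mathcal{A}|\le F$ for all $i\in\mathcal{N}$. W-MSR algorithm with parameter $F$ (for each $i\in\mathcal{N}$, at each $t$): agent $i$ sorts the values received from $\mathcal{J}_i$ (including its own value). If at most $F$ of these values are strictly greater than $x_i[t]$, it removes all of them; otherwise it removes the $F$ largest values (ties broken arbitrarily). Likewise, if at most $F$ values are strictly less than $x_i[t]$, it removes all of them; otherwise it removes the $F$ smallest. Let $\mathcal{R}_i[t]\subseteq\mathcal{J}_i$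 be the set of agents whose values remain (so $i\in\mathcal{R}_i[t]$). Then $x_i[t+1]=\sum_{j\in\mathcal{R}_i[t]}w_{ij}[t]\,x_j[t]$, where $x_j[t]$ is the value received by $i$ from $j$. The weights satisfy $w_{ij}[t]=0$ for $j\notin\mathcal{R}_i[t]$, $w_{ij}[t]\ge\alpha$ for $j\in\mathcal{R}_i[t]$, and $\sum_j w_{ij}[t]=1$, for a fixed constant $0<\alpha<1$ independent of $i,j,t$. Reachability and strong robustness: a nonempty set $C\subseteq\mathcal{V}$ is $r$-reachable if there is $i\in C$ with $|\mathcal{V}_i\setminus C|\ge r$. The graph is strongly $r$-robust with respect to $S\subset\mathcal{V}$ if every nonempty $C\subseteq\mathcal{V}\setminus S$ is $r$-reachable. *)

(* Defs.v *)
From mathcomp Require Import all_boot all_order all_algebra.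
From mathcomp Require Import reals.

Set Implicit Arguments.
Unset Strict Implicit.
Unset Printing Implicit Defensive.
Import Order.TTheory GRing.Theory Num.Theory.
Local Open Scope ring_scope.

Section Network.
Variables (n : nat) (edge : rel 'I_n).

(* [edge j i] means that i receives information from j. *)
Definition in_nbrs (i : 'I_n) : {set 'I_n} := [set j | edge j i].

Definition incl_nbrs (i : 'I_n) : {set 'I_n} := i |: in_nbrs i.

Definition normal_agents (L A : {set 'I_n}) : {set 'I_n} := ~: (L :|: A).

Definition F_local (F : nat) (L A : {set 'I_n}) : Prop :=
  forall i, i \in normal_agents L A -> (#|incl_nbrs i :&: A| <= F)%N.

Definition reachable (r : nat) (C : {set 'I_n}) : Prop :=
  exists2 i, i \in C & (r <= #|in_nbrs i :\: C|)%N.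

Definition strongly_robust (r : nat) (S : {set 'I_n}) : Prop :=
  forall C : {set 'I_n}, C != set0 -> C \subset ~: S -> reachable r C.

End Network.

Section WMSR.
Variables (R : realType) (n : nat).

(* Of the values [v j], j in J, the ones discarded from above by an agent in
   state c.  A relation and not a function of the data, because ties may be
   broken arbitrarily. *)
Definition removed_high (F : nat) (J : {set 'I_n}) (v : 'I_n -> R) (c : R)
    (T : {set 'I_n}) : Prop :=
  let above := [set j in J | c < v j] in
  if (#|above| <= F)%N then T = above
  else [/\ T \subset J, #|T| = F &
           forall j k, j \in T -> k \in J :\: T -> v k <= v j].

Definition removed_low (F : nat) (J : {set 'I_n}) (v : 'I_n -> R) (c : R)
    (T : {set 'I_n}) : Prop :=
  let below := [set j in J | v j < c] in
  if (#|below| <= F)%N then T = below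
  else [/\ T \subset J, #|T| = F &
           forall j k, j \in T -> k \in J :\: T -> v j <= v k].

Definition retained (F : nat) (J : {set 'I_n}) (v : 'I_n -> R) (c : R)
    (K : {set 'I_n}) : Prop :=
  exists H B, [/\ removed_high F J v c H, removed_low F J v c B &
                  K = J :\: (H :|: B)].

(* One W-MSR step of an agent: it is in state c, receives the value [v j] from
   each j in its inclusive neighborhood J, retains the agents in K, and moves
   to state c' using the weights [w j]. *)
Definition wmsr_step (F : nat) (alpha : R) (J : {set 'I_n}) (v : 'I_n -> R)
    (c : R) (K : {set 'I_n}) (w : 'I_n -> R) (c' : R) : Prop :=
  [/\ retained F J v c K,
      forall j, j \notin K -> w j = 0,
      forall j, j \in K -> alpha <= w j,
      \sum_j w j = 1 &
      c' = \sum_(j in K) w j * v j].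

End WMSR.

(* Main.v *)
(** After the reference has settled at [CL], let [V] bound the distance to [CL] of
    all normal agents.  Trimming keeps every retained value within [V] of [CL],
    so [V] never grows.  If the normal agents in [S] and the well-behaved leaders
    are within [b] of [CL], robustness applied to the remaining normal agents
    yields one of them with more than [F] truthful in-neighbors within [b]; it
    either lies within [b] itself on the side considered or retains one of these
    in-neighbors, so its new distance is at most [V - alpha * (V - b)].  Hence [S]
    gains an agent at each step, and after [n] steps all normal agents are within
    [(1 - alpha ^+ n) * V]. *)

Require Import Defs.
From HB Require Import structures.
From mathcomp Require Import all_boot all_order all_algebra.
From mathcomp Require Import all_classical all_reals all_analysis.
From mathcomp Require Import zify ring lra.

Set Implicit Arguments.
Unset Strict Implicit.
Unset Printing Implicit Defensive.
Import Order.TTheory GRing.Theory Num.Theory.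
Import numFieldNormedType.Exports.
Local Open Scope classical_set_scope.
Local Open Scope ring_scope.

(** * One W-MSR update of a single agent *)

Section TrimmedStep.
Variables (R : realType) (n : nat) (F : nat).
Implicit Types (J K H B G A : {set 'I_n}) (v w : 'I_n -> R) (c : R).

(** When more than [F] values exceed [c], the [F] discarded agents cannot include all of their
    senders, and every discarded value is at least the one left over. *)
Lemma removed_high_gt J v c H j : removed_high F J v c H -> j \in H -> c < v j.
Proof.
rewrite /removed_high; case: leqP => [_ -> | ltF [sHJ cardH maxH] jH].
  by rewrite inE => /andP[].
have /subsetPn[k] : ~~ ([set j in J | c < v j] \subset H).
  by apply: contraL ltF => /subset_leq_card; rewrite cardH -leqNgt.
rewrite inE => /andP[kJ ck] kH; apply: lt_le_trans ck _.
by apply: maxH; rewrite // inE kH.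
Qed.

Lemma removed_low_card J v c B : removed_low F J v c B -> (#|B| <= F)%N.
Proof. by rewrite /removed_low; case: leqP => [leF -> | _ [_ ->]]. Qed.

Lemma removed_high_opp J v c H :
  removed_high F J v c H -> removed_low F J (fun j => - v j) (- c) H.
Proof.
rewrite /removed_high /removed_low.
have -> : [set j in J | - v j < - c] = [set j in J | c < v j].
  by apply/setP=> j; rewrite !inE ltrN2.
case: ifP => // _ [sHJ cardH maxH]; split=> // j k jH kH.
by rewrite lerN2 maxH.
Qed.

Lemma removed_low_opp J v c B :
  removed_low F J v c B -> removed_high F J (fun j => - v j) (- c) B.
Proof.
rewrite /removed_high /removed_low.
have -> : [set j in J | - c < - v j] = [set j in J | v j < c].
  by apply/setP=> j; rewrite !inE ltrN2.
case: ifP => // _ [sBJ cardB minB]; split=> // j k jB kB.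
by rewrite lerN2 minB.
Qed.

(** Negation exchanges the two ends of the trimming, so lower bounds on the new state follow from
    upper bounds. *)
Lemma wmsr_step_opp (alpha : R) J v c K w c' :
  wmsr_step F alpha J v c K w c' ->
  wmsr_step F alpha J (fun j => - v j) (- c) K w (- c').
Proof.
move=> [[H [B [hH hB ->]]] w0 wge w1 ->]; split=> //.
  exists B, H; split; [exact: removed_low_opp|exact: removed_high_opp|].
  by rewrite finset.setUC.
by rewrite -sumrN; apply: eq_bigr => j _; rewrite mulrN.
Qed.

(* A retained value above [M] would force all [F] discarded high values to exceed
   [M] as well, giving [F + 1] misbehaving neighbors. *)
Lemma retained_le J v c K A (M : R) :
  retained F J v c K -> (#|J :&: A| <= F)%N -> c <= M ->
  (forall j, j \in J :\: A -> v j <= M) ->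
  forall k, k \in K -> v k <= M.
Proof.
move=> [H [B [hH _ ->]]] cardA cM vM k.
rewrite !inE negb_or -andbA => /and3P[kH _ kJ]; rewrite leNgt; apply/negP => Mk.
have bad j : j \in J -> M < v j -> j \in J :&: A.
  move=> jJ Mj; rewrite inE jJ /=; apply: contraLR Mj => jA.
  by rewrite -leNgt vM // inE jA.
move: hH; rewrite /removed_high; case: leqP => [_ HE | _ [sHJ cardH maxH]].
  by move: kH; rewrite HE inE kJ (le_lt_trans cM Mk).
have sub : k |: H \subset J :&: A.
  rewrite finset.subUset finset.sub1set bad //=; apply/fintype.subsetP => j jH.
  apply: bad; first exact: (fintype.subsetP sHJ).
  by apply: lt_le_trans Mk _; apply: maxH; rewrite // inE kH.
have := leq_trans (subset_leq_card sub) cardA.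
by rewrite cardsU1 kH cardH ltnn.
Qed.

(** Both ends discard only values strictly different from [c]. *)
Lemma retained_self J v c K i :
  retained F J v c K -> i \in J -> v i = c -> i \in K.
Proof.
move=> [H [B [hH hB ->]]] iJ vi.
rewrite !inE iJ andbT negb_or; apply/andP; split; apply/negP.
  by move/(removed_high_gt hH); rewrite vi ltxx.
by move/(removed_high_gt (removed_low_opp hB)); rewrite vi ltxx.
Qed.

(** Trimming from below takes at most [F] agents, so it cannot exhaust [G]; trimming from above
    takes only values greater than [c], hence greater than [b]. *)
Lemma retained_le_ex J v c K G (b : R) :
  retained F J v c K -> b < c -> G \subset J -> (F < #|G|)%N ->
  (forall j, j \in G -> v j <= b) -> exists2 k, k \in K & v k <= b.
Proof.
move=> [H [B [hH hB ->]]] bc sGJ cardG vG.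
have /subsetPn[k kG kB] : ~~ (G \subset B).
  apply: contraL cardG => /subset_leq_card leG; rewrite -leqNgt.
  exact: leq_trans leG (removed_low_card hB).
exists k; last exact: vG.
rewrite !inE (negbTE kB) orbF (fintype.subsetP sGJ) // andbT.
apply/negP => /(removed_high_gt hH); apply/negP; rewrite -leNgt.
exact: le_trans (vG _ kG) (ltW bc).
Qed.

Lemma wmsr_step_le (alpha : R) J v c K w c' A i G (M b : R) :
  0 <= alpha -> wmsr_step F alpha J v c K w c' ->
  i \in J -> v i = c -> c <= M -> (#|J :&: A| <= F)%N ->
  (forall j, j \in J :\: A -> v j <= M) -> b <= M ->
  c <= b \/ [/\ G \subset J, (F < #|G|)%N & forall j, j \in G -> v j <= b] ->
  c' <= M - alpha * (M - b).
Proof.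
move=> alpha0 [ret w0 wge w1 ->] iJ vi cM cardA vM bM near_b.
(* The witness is [i] itself if [c <= b], and otherwise a surviving member of [G]. *)
have [k kK vk] : exists2 k, k \in K & v k <= b.
  have [cb|bc] := leP c b.
    by exists i; rewrite ?vi //; apply: retained_self ret iJ vi.
  case: near_b => [|[sGJ cardG vG]]; first by rewrite leNgt bc.
  exact: retained_le_ex ret bc sGJ cardG vG.
have leM := retained_le ret cardA cM vM.
have wK1 : \sum_(j in K) w j = 1.
  by rewrite -[RHS]w1 [RHS](bigID (mem K)) /= [X in _ + X]big1 ?addr0 //.
(* The gap between [M] and the new state is a weighted sum of nonnegative gaps [M - v j]; the term
   of [k] alone is at least [alpha * (M - b)]. *)
have -> : \sum_(j in K) w j * v j = M - \sum_(j in K) w j * (M - v j).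
  have -> : \sum_(j in K) w j * (M - v j)
          = \sum_(j in K) w j * M - \sum_(j in K) w j * v j.
    by rewrite -sumrB; apply: eq_bigr => j _; rewrite mulrBr.
  by rewrite -mulr_suml wK1 mul1r subKr.
rewrite lerD2l lerN2 (bigD1 k) //=.
apply: le_trans (_ : w k * (M - v k) <= _).
  by apply: ler_pM; rewrite ?subr_ge0 ?wge ?lerD2l ?lerN2.
rewrite lerDl sumr_ge0 // => j /andP[jK _].
by rewrite mulr_ge0 ?subr_ge0 ?leM // (le_trans alpha0) ?wge.
Qed.

(** The one-sided estimate is applied to the values and to their negations; the retained witness may
    differ between the two sides. *)
Lemma wmsr_step_dist (alpha : R) J v c K w c' A i G (C V b : R) :
  0 <= alpha -> wmsr_step F alpha J v c K w c' ->
  i \in J -> v i = c -> `|c - C| <= V -> (#|J :&: A| <= F)%N ->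
  (forall j, j \in J :\: A -> `|v j - C| <= V) -> b <= V ->
  `|c - C| <= b \/
    [/\ G \subset J, (F < #|G|)%N & forall j, j \in G -> `|v j - C| <= b] ->
  `|c' - C| <= V - alpha * (V - b).
Proof.
move=> alpha0 step iJ vi cV cardA vV bV near_b.
have upE (z e : R) : `|z - C| <= e -> z <= C + e.
  by rewrite ler_distl => /andP[_].
have dnE (z e : R) : `|z - C| <= e -> - z <= - C + e.
  by rewrite ler_distl => /andP[h _]; rewrite lerNl opprD opprK.
have up : c' <= (C + V) - alpha * ((C + V) - (C + b)).
  apply: (wmsr_step_le (G := G) alpha0 step iJ vi _ cardA) => [|j jJ||].
  - exact: upE.
  - by apply/upE/vV.
  - by rewrite lerD2l.
  - case: near_b => [cb|[sGJ cardG vG]]; [left; exact: upE|right].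
    by split=> // j jG; apply/upE/vG.
have dn : - c' <= (- C + V) - alpha * ((- C + V) - (- C + b)).
  apply: (wmsr_step_le (G := G) alpha0 (wmsr_step_opp step) iJ _ _ cardA)
    => [|| j jJ||].
  - by rewrite vi.
  - exact: dnE.
  - by apply/dnE/vV.
  - by rewrite lerD2l.
  - case: near_b => [cb|[sGJ cardG vG]]; [left; exact: dnE|right].
    by split=> // j jG; apply/dnE/vG.
have e (a : R) : a + V - (a + b) = V - b by rewrite opprD addrACA subrr add0r.
move: up dn; rewrite !e => up dn.
rewrite ler_distl; apply/andP; split; lra.
Qed.

End TrimmedStep.

(** * Propagation of the distance bounds through the network *)

Section Network.
Variables (R : realType) (n : nat) (edge : rel 'I_n) (L A : {set 'I_n}).
Variables (F : nat) (alpha : R).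
Variables (x : nat -> 'I_n -> R) (y : nat -> 'I_n -> 'I_n -> R).
Variables (K : nat -> 'I_n -> {set 'I_n}) (w : nat -> 'I_n -> 'I_n -> R).
Local Notation N := (normal_agents L A).
Hypothesis alpha_ge0 : 0 <= alpha.
Hypothesis alpha_le1 : alpha <= 1.
Hypothesis truthful : forall t i j, j \notin A -> j \in incl_nbrs edge i ->
  y t i j = x t j.
Hypothesis A_local : F_local edge F L A.
Hypothesis normal_wmsr : forall t i, i \in N ->
  wmsr_step F alpha (incl_nbrs edge i) (y t i) (x t i)
    (K t i) (w t i) (x t.+1 i).
Hypothesis robust : strongly_robust edge (2 * F + 1) L.
Variables (tC : nat) (CL : R).
Hypothesis leadersC : forall t j, (tC <= t)%N -> j \in L :\: A -> x t j = CL.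

Lemma normal_notin i : i \in N -> i \notin A.
Proof. by rewrite !inE negb_or => /andP[]. Qed.

(** A truthful agent that is not normal is a leader, sitting exactly at [CL]. *)
Lemma truthful_dist t j b : (tC <= t)%N -> 0 <= b -> j \notin A ->
  (j \in N -> `|x t j - CL| <= b) -> `|x t j - CL| <= b.
Proof.
move=> tCt b0 jA; have [jL _|jL] := boolP (j \in L).
  by rewrite leadersC ?subrr ?normr0 // inE jA.
by apply; rewrite !inE negb_or jL.
Qed.

Lemma normal_step t i (G : {set 'I_n}) (V b : R) :
  (tC <= t)%N -> i \in N ->
  (forall j, j \in N -> `|x t j - CL| <= V) -> b <= V ->
  `|x t i - CL| <= b \/
    [/\ G \subset incl_nbrs edge i :\: A, (F < #|G|)%N &
        forall j, j \in G -> `|x t j - CL| <= b] ->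
  `|x t.+1 i - CL| <= V - alpha * (V - b).
Proof.
move=> tCt iN hV bV near_b.
have V0 : 0 <= V by apply: le_trans (hV i iN).
have iJ : i \in incl_nbrs edge i by rewrite !inE eqxx.
apply: (wmsr_step_dist (G := G) alpha_ge0 (normal_wmsr t iN) iJ _ _
          (A_local iN)) => //.
- by rewrite truthful ?normal_notin.
- exact: hV.
- move=> j; rewrite inE => /andP[jA jJ].
  by rewrite truthful //; apply: truthful_dist => //; exact: hV.
- case: near_b => [|[sG cardG Gb]]; [by left|right].
  split=> //; first exact: fintype.subset_trans sG (finset.subsetDl _ _).
  move=> j jG; have := fintype.subsetP sG _ jG; rewrite inE => /andP[jA jJ].
  by rewrite truthful // Gb.
Qed.

Lemma normal_bound_step t (V : R) : (tC <= t)%N ->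
  (forall j, j \in N -> `|x t j - CL| <= V) ->
  forall j, j \in N -> `|x t.+1 j - CL| <= V.
Proof.
move=> tCt hV j jN.
(* With [b = V] each agent is its own witness, so [G] may be empty. *)
have -> : V = V - alpha * (V - V) by rewrite subrr mulr0 subr0.
by apply: (normal_step (G := finset.set0) tCt jN hV) => //; left; exact: hV.
Qed.

Lemma normal_bound t t' (V : R) : (tC <= t)%N -> (t <= t')%N ->
  (forall j, j \in N -> `|x t j - CL| <= V) ->
  forall j, j \in N -> `|x t' j - CL| <= V.
Proof.
move=> tCt /subnKC <- hV; elim: (t' - t)%N => [|k IHk]; first by rewrite addn0.
rewrite addnS; apply: normal_bound_step => //.
exact: leq_trans tCt (leq_addr _ _).
Qed.

(** This is where [2 * F + 1] enters: some agent of [N :\: S] has that many in-neighbors outside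
    [N :\: S], at most [F] of them misbehave, and the others, more than [F], are leaders or members
    of [S]. *)
Lemma robust_normal (S : {set 'I_n}) : S \proper N ->
  exists2 i, i \in N :\: S &
    exists G : {set 'I_n}, [/\ G \subset incl_nbrs edge i :\: A, (F < #|G|)%N &
      forall j, j \in G -> j \in N -> j \in S].
Proof.
rewrite finset.properEneq => /andP[SN sSN].
have [||i iNS cardi] := robust (C := N :\: S).
- apply: contra SN => /eqP NS0.
  by rewrite finset.eqEsubset sSN -finset.setD_eq0 NS0 eqxx.
- by apply/fintype.subsetP => j; rewrite !inE !negb_or => /and3P[].
exists i => //; exists ((in_nbrs edge i :\: (N :\: S)) :\: A).
have iN : i \in N by move: iNS; rewrite finset.inE => /andP[].
split.
- apply/fintype.subsetP => j.
  rewrite !finset.in_setD /incl_nbrs finset.in_setU1 => /and3P[-> _ ->].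
  by rewrite orbT.
- have := finset.cardsID A (in_nbrs edge i :\: (N :\: S)).
  have : (#|(in_nbrs edge i :\: (N :\: S)) :&: A| <= F)%N.
    apply: leq_trans (A_local iN); apply: subset_leq_card.
    apply/fintype.subsetP => j; rewrite !finset.inE => /andP[/andP[_ ->] ->].
    by rewrite orbT.
  lia.
- move=> j; rewrite finset.in_setD => /andP[_].
  rewrite finset.in_setD => /andP[jC _] jN.
  by move: jC; rewrite finset.in_setD jN andbT negbK.
Qed.

(** The radii [b_k = (1 - alpha ^+ k) * V] solve [b_(k+1) = V - alpha * (V - b_k)] with [b_0 = 0].
    The set [S] can start empty because the leaders are already at distance 0. *)
Lemma normal_spread t (V : R) k : (tC <= t)%N -> 0 <= V ->
  (forall j, j \in N -> `|x t j - CL| <= V) ->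
  exists S : {set 'I_n}, [/\ S \subset N, (minn k #|N| <= #|S|)%N &
    forall j, j \in S -> `|x (t + k)%N j - CL| <= (1 - alpha ^+ k) * V].
Proof.
move=> tCt V0 hV; elim: k => [|k [S [sSN cardS Sb]]].
  by exists finset.set0; split=> [||j]; rewrite ?finset.sub0set ?min0n // finset.inE.
have tCtk : (tC <= t + k)%N by exact: leq_trans tCt (leq_addr _ _).
have hVk := normal_bound tCt (leq_addr k t) hV.
have alphak0 : 0 <= alpha ^+ k by exact: exprn_ge0.
have b0 : 0 <= (1 - alpha ^+ k) * V by rewrite mulr_ge0 ?subr_ge0 ?exprn_ile1.
have bV : (1 - alpha ^+ k) * V <= V by rewrite mulrBl mul1r gerBl mulr_ge0.
have bE : (1 - alpha ^+ k.+1) * V = V - alpha * (V - (1 - alpha ^+ k) * V).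
  by rewrite exprS; ring.
(* Members of [S] stay within the next radius, each being its own witness. *)
have keep j : j \in S -> `|x (t + k).+1 j - CL| <= (1 - alpha ^+ k.+1) * V.
  move=> jS; rewrite bE.
  apply: (normal_step (G := finset.set0) tCtk (fintype.subsetP sSN _ jS) hVk bV).
  by left; exact: Sb.
(* Either [S] already contains every normal agent, or robustness supplies a new member. *)
rewrite addnS; have [NS|SN] := boolP (N \subset S).
  exists S; split=> //; apply: leq_trans (subset_leq_card NS); exact: geq_minr.
have [|i iNS [G [sG cardG GS]]] := @robust_normal S; first by rewrite properE sSN.
have [iN iS] : i \in N /\ i \notin S by apply/andP; rewrite andbC -finset.in_setD.
exists (i |: S); split=> [||j].
- by rewrite finset.subUset finset.sub1set iN.
- by rewrite finset.cardsU1 iS; move: cardS; lia.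
rewrite finset.in_setU1 => /orP[/eqP ->|]; last exact: keep.
rewrite bE; apply: (normal_step tCtk iN hVk bV); right.
split; [exact: sG|exact: cardG|move=> j' j'G].
have := fintype.subsetP sG _ j'G; rewrite finset.in_setD => /andP[j'A _].
by apply: truthful_dist => // j'N; exact/Sb/GS.
Qed.

Lemma normal_contract t (V : R) : (tC <= t)%N -> 0 <= V ->
  (forall j, j \in N -> `|x t j - CL| <= V) ->
  forall j, j \in N -> `|x (t + n)%N j - CL| <= (1 - alpha ^+ n) * V.
Proof.
move=> tCt V0 hV j jN.
have [S [sSN cardS Sb]] := normal_spread n tCt V0 hV.
apply: Sb; suff -> : S = N by [].
(* There are at most [n] normal agents, so [n] steps are enough to fill [N]. *)
apply/eqP; rewrite finset.eqEcard sSN; apply: leq_trans cardS.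
by rewrite leq_min leqnn andbT -[leqRHS]card_ord max_card.
Qed.

(** Each block of [n] steps contracts the bound once; monotonicity of the bound covers the times
    between and after blocks. *)
Lemma normal_geometric (V : R) m : 0 <= V ->
  (forall j, j \in N -> `|x tC j - CL| <= V) ->
  forall t, (tC + n * m <= t)%N ->
  forall j, j \in N -> `|x t j - CL| <= (1 - alpha ^+ n) ^+ m * V.
Proof.
move=> V0 hV t tge; apply: normal_bound tge _; first exact: leq_addr.
elim: m => [|m IHm]; first by rewrite muln0 addn0 expr0 mul1r.
rewrite mulnS addnCA addnC exprS -mulrA.
apply: normal_contract IHm; first exact: leq_addr.
by rewrite mulr_ge0 // exprn_ge0 // subr_ge0 exprn_ile1.
Qed.

End Network.

(* x t i : state of agent i;  y t i j : value received by i from j;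
   K t i : agents retained by i;  w t i j : weight given by i to j. *)
Theorem theorem1 (R : realType) (n : nat) (edge : rel 'I_n)
    (L A : {set 'I_n}) (F : nat) (alpha : R)
    (fr : nat -> R -> R) (xr : nat -> R)
    (x : nat -> 'I_n -> R) (y : nat -> 'I_n -> 'I_n -> R)
    (K : nat -> 'I_n -> {set 'I_n}) (w : nat -> 'I_n -> 'I_n -> R)
    (edge_irr : irreflexive edge)
    (alpha_bounds : 0 < alpha < 1)
    (ref_dyn : forall t, xr t.+1 = fr t (xr t))
    (leaders : forall t i, i \in L :\: A -> x t i = xr t)
    (truthful : forall t i j, j \notin A -> j \in incl_nbrs edge i ->
       y t i j = x t j)
    (A_local : F_local edge F L A)
    (normal_wmsr : forall t i, i \in normal_agents L A ->
       wmsr_step F alpha (incl_nbrs edge i) (y t i) (x t i)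
         (K t i) (w t i) (x t.+1 i))
    (ref_const : exists (tC : nat) (CL : R),
       forall t, (tC <= t)%N -> xr t = CL)
    (robust : strongly_robust edge (2 * F + 1) L) :
  forall i, i \in normal_agents L A ->
    (fun t => `|x t i - xr t|) @ \oo --> (0 : R).
Proof.
have [tC [CL xrC]] := ref_const.
have alpha0 : 0 < alpha by case/andP: alpha_bounds.
have alpha1 : alpha < 1 by case/andP: alpha_bounds.
move=> i iN.
have [V0 V0P] : exists V0, forall j, j \in normal_agents L A ->
    `|x tC j - CL| <= V0.
  (* The sum of all the distances serves as a common bound. *)
  exists (\sum_j `|x tC j - CL|) => j _.
  by rewrite (bigD1 j) //= lerDl sumr_ge0.
have V0_ge0 : 0 <= V0 by apply: le_trans (V0P i iN).
have leadersC t j : (tC <= t)%N -> j \in L :\: A -> x t j = CL.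
  by move=> tCt jL; rewrite leaders ?xrC.
have bound := normal_geometric (ltW alpha0) (ltW alpha1) truthful A_local
  normal_wmsr robust leadersC.
have n_gt0 : (0 < n)%N by apply: leq_ltn_trans (ltn_ord i).
set q := 1 - alpha ^+ n in bound.
have qlt1 : `|q| < 1.
  have h0 : 0 < alpha ^+ n by rewrite exprn_gt0.
  have h1 : alpha ^+ n <= 1 by rewrite exprn_ile1 // ltW.
  by rewrite ger0_norm /q ?subr_ge0 // ltrBlDr ltrDl.
apply/cvgrPdist_lt => e e0.
have /cvgrPdist_lt/(_ e e0) [m _ mP] : (fun k => V0 * q ^+ k) @ \oo --> (0 : R).
  by rewrite -(mulr0 V0); apply: cvgMr; exact: cvg_expr.
(* The [m] contractions needed to get below [e] take [n * m] steps after [tC]. *)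
exists (tC + n * m)%N => // t /= tge.
have tCt : (tC <= t)%N by apply: leq_trans tge; rewrite leq_addr.
rewrite xrC // sub0r normrN normr_id.
apply: le_lt_trans (bound _ m _ V0P t tge _ iN) _ => //.
have := mP m (leqnn m); rewrite /= sub0r normrN.
by apply: le_lt_trans; rewrite mulrC ler_norm.
Qed.
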